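(* Let $\theta>0$ be arbitrary and $n\ge 2$. Then $$\tau_n(\theta):=\sup\left\{\frac{D_n(\bar a)}{\theta B_n(\bar a)}:\ \bar a\in\mathbf{R}^n\setminus\{0\}\right\}=\frac{\theta+2}{\theta+1}.$$ The supremum is achieved by taking $a_j=(\theta+2)j^2-(2n+\theta)j$ for $1\le j\le n$.
   Context: Let $\mathbf{S}_n$ be the symmetric group of permutations of $n$ letters. For $\sigma\in\mathbf{S}_n$, let $w(\sigma)$ be the number of cycles in the decomposition of $\sigma$ into disjoint cycles (fixed points counted as cycles of length 1), and let $k_j(\sigma)\ge 0$ be the number of cycles of length $j$, $1\le j\le n$. Write $(x)_m=x(x+1)\cdots(x+m-1)$ for $m\in\{0,1,2,\dots\}$ (with $(x)_0=1$) and, for a parameter $\theta>0$, $\Theta(m)=(\theta)_m/m!$. The Ewens probability measure $\nu_{n,\theta}$ on $\mathbf{S}_n$ is defined by $\nu_{n,\theta}(\{\sigma\})=\theta^{w(\sigma)}/(\theta)_n$, $\sigma\in\mathbf{S}_n$. For $\bar a=(a_1,\dots,a_n)\in\mathbf{R}^n$, $D_n(\bar a)$ denotes the variance, with respect to $\nu_{n,\theta}$, of the random variable $h(\sigma)=a_1k_1(\sigma)+\cdots+a_nk_n(\sigma)$, and $$B_n(\bar a)=\sum_{j=1}^n\frac{a_j^2}{j}\,\frac{\Theta(n-j)}{\Theta(n)}.$$ *)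

(* Defs.v *)
From HB Require Import structures.
From mathcomp Require Import all_boot all_order all_algebra all_fingroup.
From mathcomp Require Import classical_sets reals.

Set Implicit Arguments.
Unset Strict Implicit.
Unset Printing Implicit Defensive.

Import Order.TTheory GRing.Theory Num.Theory.
Local Open Scope ring_scope.
Local Open Scope classical_set_scope.

Section FiniteProbability.
Context {R : realType} {T : finType}.

(* Probability measures on a finite type are given by their point masses. *)
Definition mass_expectation (p : T -> R) (X : T -> R) : R :=
  \sum_(t : T) p t * X t.

Definition mass_variance (p : T -> R) (X : T -> R) : R :=
  mass_expectation p (fun t => (X t - mass_expectation p X) ^+ 2).

End FiniteProbability.

Section Ewens.
Context {R : realType}.

Definition rising (x : R) (m : nat) : R := \prod_(i < m) (x + i%:R).

Definition Theta (theta : R) (m : nat) : R := rising theta m / m`!%:R.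

(* [porbits s] includes the singleton orbits, so fixed points are cycles of
   length 1. *)
Definition ncycles (n : nat) (s : 'S_n) : nat := #|porbits s|.

Definition ncycles_of_length (n : nat) (j : nat) (s : 'S_n) : nat :=
  #|[set C in porbits s | #|C| == j]|.

Definition ewens (n : nat) (theta : R) (s : 'S_n) : R :=
  theta ^+ ncycles s / rising theta n.

(* Vectors are indexed from 0: the entry [a 0 j] is the coefficient usually
   written a_(j+1), for cycles of length j+1. *)
Definition additive_fun (n : nat) (a : 'rV[R]_n) (s : 'S_n) : R :=
  \sum_(j < n) a 0 j * (ncycles_of_length j.+1 s)%:R.

Definition Dn (n : nat) (theta : R) (a : 'rV[R]_n) : R :=
  mass_variance (@ewens n theta) (additive_fun a).

Definition Bn (n : nat) (theta : R) (a : 'rV[R]_n) : R :=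
  \sum_(j < n) a 0 j ^+ 2 / j.+1%:R * (Theta theta (n - j.+1) / Theta theta n).

Definition variance_ratio (n : nat) (theta : R) (a : 'rV[R]_n) : R :=
  Dn theta a / (theta * Bn theta a).

(* [sup] is 0 on sets that are empty or not bounded above, so an equation
   between [tau] and a nonzero real also says that the supremum exists. *)
Definition tau (n : nat) (theta : R) : R :=
  sup [set variance_ratio theta a | a in [set a : 'rV[R]_n | a != 0]].

Definition extremal_vector (n : nat) (theta : R) : 'rV[R]_n :=
  \row_(j < n) ((theta + 2) * j.+1%:R ^+ 2 - (2 * n%:R + theta) * j.+1%:R).

End Ewens.

(* Main.v *)
(** With [x_j = a_j / j], the factorial moments of the cycle counts turn
    [D_n / (theta B_n)] into [1 + <x, K x> / <x, x>], where
    [<x, y> = sum_j j Theta(n - j) x_j y_j] and [K] is the self-adjoint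
    operator with
    [(K x)_i = theta / (i Theta(n - i)) *
       (sum_(j <= n - i) x_j Theta(n - i - j)
        - Theta(n - i) / Theta(n) * sum_j x_j Theta(n - j))].
    On a rising factorial [x_j = (j)_k] the convolutions are explicit and
    [(K x)_i = k! / (theta + 1)_k *
       ((n - i) (theta + n - i)_k - n (theta + n)_k) / i],
    a polynomial in [i] of degree [k] with leading coefficient
    [lambda_k = (-1)^(k+1) k! / (theta + 1)_k].  So [K] is triangular with
    respect to the degree, and being self-adjoint it has the eigenvalues
    [lambda_k]; the largest one is [lambda_1 = 1 / (theta + 1)], with
    eigenvector [(theta + 2) j - (2 n + theta)].

    The moments come from the recursion that builds a permutation of [n + 1]
    points from one of [n] points by either adding a fixed point, with weight
    [theta], or inserting the new point in a cycle after an old point. *)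

Require Import Defs.
From HB Require Import structures.
From mathcomp Require Import all_boot all_order all_algebra all_fingroup.
From mathcomp Require Import classical_sets reals.
From mathcomp Require Import fintype finset ring lra.

Set Implicit Arguments.
Unset Strict Implicit.
Unset Printing Implicit Defensive.

Import Order.TTheory GRing.Theory Num.Theory.
Local Open Scope ring_scope.

(** * Cycles under insertion of a point *)

(** Products act from left to right: the new point goes to [i] and the old preimage of [i] goes to
    the new point. For [i = ord_max] the new point is fixed. *)
Definition insert_max n (s : 'S_n) (i : 'I_n.+1) : 'S_n.+1 :=
  (lift_perm ord_max ord_max s * tperm ord_max i)%g.

Lemma insert_max_inj n : injective (fun si : 'S_n * 'I_n.+1 => insert_max si.1 si.2).
Proof.
move=> [s i] [t j] /= e.
have eij : i = j.
  by move/permP/(_ ord_max): e; rewrite !permM !lift_perm_id !tpermL.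
rewrite eij in e *; move/mulIg/permP: e => e; congr (_, _); apply/permP => y.
by apply: (@lift_inj _ ord_max); rewrite -!(lift_perm_lift ord_max ord_max).
Qed.

Lemma sum_ord_max (R : realType) n (F : 'I_n.+1 -> R) :
  \sum_i F i = F ord_max + \sum_y F (lift ord_max y).
Proof.
rewrite big_ord_recr /= addrC; congr (_ + _); apply: eq_bigr => y _; congr F.
by apply: val_inj; rewrite /= /bump leqNgt ltn_ord.
Qed.

(** Insertion is injective, since [i] is the image of the new point, and [n! * (n + 1) = (n + 1)!]
    makes it bijective. *)
Lemma sum_insert_max (R : realType) n (F : 'S_n.+1 -> R) :
  \sum_s F s = \sum_(s : 'S_n) (F (insert_max s ord_max)
      + \sum_(y < n) F (insert_max s (lift ord_max y))).
Proof.
have bij : bijective (fun si : 'S_n * 'I_n.+1 => insert_max si.1 si.2).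
  apply: inj_card_bij; first exact: insert_max_inj.
  by rewrite card_prod !card_Sn card_ord factS mulnC.
rewrite (reindex _ (onW_bij _ bij)) /= -(pair_bigA _ (fun s i => F (insert_max s i))) /=.
by apply: eq_bigr => s _; rewrite sum_ord_max.
Qed.

Lemma porbit_closed {T : finType} (s : {perm T}) (A : {set T}) x :
  x \in A -> (forall y, y \in A -> s y \in A) -> porbit s x \subset A.
Proof.
move=> xA h; apply/subsetP => y /porbitP[k ->].
by elim: k => [|k IH]; rewrite ?perm1 // expgSr permM h.
Qed.


Lemma porbit_step {T : finType} (s : {perm T}) x y :
  y \in porbit s x -> s y \in porbit s x.
Proof. by move=> yx; rewrite -eq_porbit_mem (porbit_perm s 1 y) eq_porbit_mem. Qed.

Definition cycle_sum (R : realType) n (f : nat -> R) (s : 'S_n) : R :=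
  \sum_(C in porbits s) f #|C|.

Lemma sum_porbit (R : realType) n (f : nat -> R) (s : 'S_n) :
  \sum_x f #|porbit s x| = cycle_sum (fun l => l%:R * f l) s.
Proof.
rewrite (partition_big (porbit s) (mem (porbits s))) /=; last first.
  by move=> x _; exact: imset_f.
apply: eq_bigr => C /imsetP[z _ ->].
rewrite (eq_bigl (mem (porbit s z))) => [|x]; last by rewrite /= -eq_porbit_mem.
rewrite (eq_bigr (fun=> f #|porbit s z|)) => [|x].
  by rewrite sumr_const mulr_natl.
by rewrite inE -eq_porbit_mem => /eqP->.
Qed.

(** A cycle of length [l] is met by [l] points. Sums over points are easier to follow under
    insertion, as the orbit of each old point is known explicitly. *)
Lemma cycle_sumE (R : realType) n (f : nat -> R) (s : 'S_n) :
  cycle_sum f s = \sum_x f #|porbit s x| / #|porbit s x|%:R.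
Proof.
rewrite (sum_porbit (fun l => f l / l%:R)); apply: eq_bigr => C /imsetP[z _ ->].
by rewrite mulrC divfK // pnatr_eq0 card_porbit_neq0.
Qed.

Section InsertMax.
Variables (n : nat) (s : 'S_n).
Notation max := (@ord_max n).
Notation lft := (lift max).

Lemma insert_max_fix_max : insert_max s max max = max.
Proof. by rewrite permM lift_perm_id tpermL. Qed.

Lemma insert_max_fix_lift y : insert_max s max (lft y) = lft (s y).
Proof. by rewrite permM lift_perm_lift tperm1 perm1. Qed.

Lemma insert_max_max x : insert_max s (lft x) max = lft x.
Proof. by rewrite permM lift_perm_id tpermL. Qed.

Lemma insert_max_lift x y :
  insert_max s (lft x) (lft y) = if s y == x then max else lft (s y).
Proof.
rewrite permM lift_perm_lift; case: eqP => [->|/eqP h]; first exact: tpermR.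
by rewrite tpermD ?neq_lift // (inj_eq lift_inj) eq_sym.
Qed.

Lemma card_lift_imset (A : {set 'I_n}) : #|lft @: A| = #|A|.
Proof. by rewrite card_imset //; exact: lift_inj. Qed.

Lemma porbit_insert_max_fix_max : porbit (insert_max s max) max = [set max].
Proof.
apply/eqP; rewrite eqEsubset sub1set porbit_id andbT.
by apply: porbit_closed => [|y]; rewrite !inE // => /eqP->; rewrite insert_max_fix_max.
Qed.

Lemma lift_porbit_sub u y :
  (forall z, z \in porbit s y -> lft z \in porbit u (lft y) ->
     lft (s z) \in porbit u (lft y)) ->
  lft @: porbit s y \subset porbit u (lft y).
Proof.
move=> h; apply/subsetP => _ /imsetP[z /porbitP[k ->] ->].
elim: k => [|k IH]; first by rewrite perm1 porbit_id.
by rewrite expgSr permM h // mem_porbit.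
Qed.

Lemma porbit_insert_max_fix_lift y :
  porbit (insert_max s max) (lft y) = lft @: porbit s y.
Proof.
apply/eqP; rewrite eqEsubset; apply/andP; split.
  apply: porbit_closed => [|_ /imsetP[z zy ->]].
    by rewrite imset_f ?porbit_id.
  by rewrite insert_max_fix_lift imset_f ?porbit_step.
apply: lift_porbit_sub => z _ /porbit_step.
by rewrite insert_max_fix_lift.
Qed.

Lemma lift_porbit_insert_max x y :
  lft @: porbit s y \subset porbit (insert_max s (lft x)) (lft y).
Proof.
apply: lift_porbit_sub => z _ /porbit_step.
by rewrite insert_max_lift; case: eqP => // -> /porbit_step; rewrite insert_max_max.
Qed.

Lemma porbit_insert_max_max x :
  porbit (insert_max s (lft x)) max = max |: lft @: porbit s x.
Proof.
apply/eqP; rewrite eqEsubset; apply/andP; split.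
  apply: porbit_closed => [|_ /setU1P[->|/imsetP[z zx ->]]].
  - exact: setU11.
  - by rewrite insert_max_max setU1r // imset_f ?porbit_id.
  rewrite insert_max_lift; case: eqP => _; first exact: setU11.
  by rewrite setU1r // imset_f ?porbit_step.
rewrite subUset sub1set porbit_id.
have /eqP-> : porbit (insert_max s (lft x)) max
    == porbit (insert_max s (lft x)) (lft x).
  by rewrite eq_sym eq_porbit_mem -{1}(insert_max_max x) porbit_step ?porbit_id.
exact: lift_porbit_insert_max.
Qed.

Lemma porbit_insert_max_in x y : y \in porbit s x ->
  porbit (insert_max s (lft x)) (lft y) = max |: lft @: porbit s x.
Proof.
move=> yx; rewrite -porbit_insert_max_max; apply/eqP.
by rewrite eq_porbit_mem porbit_insert_max_max setU1r // imset_f.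
Qed.

Lemma porbit_insert_max_notin x y : y \notin porbit s x ->
  porbit (insert_max s (lft x)) (lft y) = lft @: porbit s y.
Proof.
move=> yx; apply/eqP; rewrite eqEsubset lift_porbit_insert_max andbT.
apply: porbit_closed => [|_ /imsetP[z zy ->]].
  by rewrite imset_f ?porbit_id.
rewrite insert_max_lift; case: eqP => [szx|_]; last by rewrite imset_f ?porbit_step.
by case/negP: yx; rewrite porbit_sym -szx porbit_step.
Qed.

Lemma card_max_lift (A : {set 'I_n}) : #|max |: lft @: A| = #|A|.+1.
Proof.
rewrite cardsU1 card_lift_imset.
suff -> : max \notin lft @: A by [].
by apply/imsetP => -[z _ /eqP]; rewrite (negPf (neq_lift _ _)).
Qed.

Lemma cycle_sum_insert_max_fix (R : realType) (f : nat -> R) :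
  cycle_sum f (insert_max s max) = cycle_sum f s + f 1.
Proof.
rewrite !cycle_sumE sum_ord_max porbit_insert_max_fix_max cards1 divr1 addrC.
by congr (_ + _); apply: eq_bigr => y _; rewrite porbit_insert_max_fix_lift card_lift_imset.
Qed.

(** Only the cycle through [x] changes, growing by one point. In the sum over points, its [l] old
    points and the new one now share the value [f l.+1]. *)
Lemma cycle_sum_insert_max (R : realType) (f : nat -> R) x :
  cycle_sum f (insert_max s (lft x)) =
  cycle_sum f s + f #|porbit s x|.+1 - f #|porbit s x|.
Proof.
set l := #|porbit s x|.
have l0 : l%:R != 0 :> R by rewrite pnatr_eq0 card_porbit_neq0.
rewrite !cycle_sumE sum_ord_max porbit_insert_max_max card_max_lift -/l.
rewrite (bigID (mem (porbit s x))) /= [in RHS](bigID (mem (porbit s x))) /=.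
rewrite (eq_bigr (fun=> f l.+1 / l.+1%:R)) => [|y yx]; last first.
  by rewrite porbit_insert_max_in // card_max_lift.
rewrite [in RHS](eq_bigr (fun=> f l / l%:R)) => [|y yx]; last first.
  by move: yx; rewrite -eq_porbit_mem => /eqP->.
rewrite !sumr_const -/l.
set S1 := \sum_(_ | _) _; set S2 := \sum_(_ | _) _.
have -> : S1 = S2.
  by apply: eq_bigr => y yx; rewrite porbit_insert_max_notin // card_lift_imset.
have l1 : 1 + l%:R != 0 :> R by rewrite nat1r pnatr_eq0.
rewrite -(mulr_natr (f l.+1 / _)) -(mulr_natr (f l / _)) -nat1r; field.
by rewrite l0.
Qed.
End InsertMax.

(** * Factorial moments of the cycle counts *)

Section Moments.
Variables (R : realType) (theta : R).

Definition count_cycles n j (s : 'S_n) : R := (ncycles_of_length j s)%:R.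

Lemma count_cyclesE n j (s : 'S_n) :
  count_cycles j s = cycle_sum (fun l => (l == j)%:R) s.
Proof.
rewrite /count_cycles /ncycles_of_length -sum1_card natr_sum /cycle_sum.
rewrite big_mkcond [RHS]big_mkcond; apply: eq_bigr => C _; rewrite !inE.
by case: (C \in _); case: (_ == _).
Qed.

Lemma ncyclesE n (s : 'S_n) : (ncycles s)%:R = cycle_sum (fun=> 1) s :> R.
Proof. by rewrite /ncycles -sum1_card natr_sum. Qed.

Lemma ncycles_insert_max_fix n (s : 'S_n) :
  ncycles (insert_max s ord_max) = (ncycles s).+1.
Proof.
apply/eqP; rewrite -(eqr_nat R) ncyclesE cycle_sum_insert_max_fix -ncyclesE.
by rewrite -natr1.
Qed.

Lemma ncycles_insert_max n (s : 'S_n) y :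
  ncycles (insert_max s (lift ord_max y)) = ncycles s.
Proof.
by apply/eqP; rewrite -(eqr_nat R) ncyclesE cycle_sum_insert_max addrK -ncyclesE.
Qed.

Lemma count_cycles_insert_max_fix n j (s : 'S_n) :
  count_cycles j (insert_max s ord_max) = count_cycles j s + (1 == j)%:R.
Proof. by rewrite !count_cyclesE cycle_sum_insert_max_fix. Qed.

Lemma count_cycles_insert_max n j (s : 'S_n) y :
  count_cycles j (insert_max s (lift ord_max y)) = count_cycles j s
    + (#|porbit s y|.+1 == j)%:R - (#|porbit s y| == j)%:R.
Proof. by rewrite !count_cyclesE cycle_sum_insert_max. Qed.

Lemma sum_porbit_eq n j (s : 'S_n) :
  \sum_y (#|porbit s y| == j)%:R = j%:R * count_cycles j s.
Proof.
rewrite (sum_porbit (fun l => (l == j)%:R)) count_cyclesE /cycle_sum mulr_sumr.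
by apply: eq_bigr => C _; case: eqP => [->|]; rewrite ?mulr1 ?mulr0.
Qed.

(** Left unnormalised, so that the recursion in [n] involves no division; the expectation is the
    quotient by [rising theta n]. *)
Definition ewens_sum n (X : 'S_n -> R) : R := \sum_s theta ^+ ncycles s * X s.

Lemma ewens_sumD n (X Y : 'S_n -> R) : ewens_sum (fun s => X s + Y s) =
  ewens_sum X + ewens_sum Y.
Proof. by rewrite /ewens_sum -big_split; apply: eq_bigr => s _; rewrite mulrDr. Qed.

Lemma ewens_sumZ n c (X : 'S_n -> R) : ewens_sum (fun s => c * X s) = c * ewens_sum X.
Proof. by rewrite /ewens_sum mulr_sumr; apply: eq_bigr => s _; rewrite mulrCA. Qed.

Lemma eq_ewens_sum n (X Y : 'S_n -> R) : X =1 Y -> ewens_sum X = ewens_sum Y.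
Proof. by move=> h; apply: eq_bigr => s _; rewrite h. Qed.

Lemma ewens_sum_rec n (X : 'S_n.+1 -> R) :
  ewens_sum X = ewens_sum (fun s : 'S_n => theta * X (insert_max s ord_max)
                  + \sum_y X (insert_max s (lift ord_max y))).
Proof.
rewrite /ewens_sum sum_insert_max; apply: eq_bigr => s _.
rewrite ncycles_insert_max_fix exprS mulrDr mulr_sumr; congr (_ + _).
  by rewrite [RHS]mulrCA mulrA.
by apply: eq_bigr => y _; rewrite ncycles_insert_max.
Qed.

Lemma ewens_sum1 n : ewens_sum (fun _ : 'S_n => 1) = rising theta n.
Proof.
elim: n => [|n IH]; last first.
  rewrite /rising big_ord_recr /= -[X in X * _]IH ewens_sum_rec [RHS]mulrC -ewens_sumZ.
  by apply: eq_ewens_sum => s; rewrite sumr_const card_ord !mulr1.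
rewrite /rising big_ord0 /ewens_sum (eq_bigr (fun=> 1)) => [|s _].
  by rewrite sumr_const card_Sn.
rewrite /ncycles (_ : porbits s = set0) ?cards0 ?expr0 ?mulr1 //.
by apply/setP => C; rewrite inE; apply/imsetP => -[[]].
Qed.

Lemma count_cycles_S0 j (s : 'S_0) : count_cycles j s = 0.
Proof. by rewrite count_cyclesE cycle_sumE big_ord0. Qed.

(* Truncated subtraction would give [Theta theta 0 = 1] instead of [0] for [n < m]. *)
Definition Theta0 n m : R := if (m <= n)%N then Theta theta (n - m) else 0.

Lemma Theta_rec m : m.+1%:R * Theta theta m.+1 = (theta + m%:R) * Theta theta m.
Proof.
rewrite /Theta /rising big_ord_recr /= factS natrM; field.
by rewrite nat1r !pnatr_eq0 -lt0n fact_gt0.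
Qed.

Lemma rising_Theta n : rising theta n = n`!%:R * Theta theta n.
Proof. by rewrite /Theta mulrC divfK // pnatr_eq0 -lt0n fact_gt0. Qed.

(** This carries the inductions for both moments. At [n = m] the right side vanishes through its
    factor, the left one through [Theta0]. *)
Lemma Theta0_rec n m :
  (theta + n%:R - m.+1%:R) * Theta0 n m.+1 = (n%:R - m%:R) * Theta0 n m.
Proof.
rewrite /Theta0; case: ltngtP => [lt|gt|->].
- rewrite -addrA -!natrB //; last exact: ltnW.
  by rewrite -Theta_rec subnSK.
- by rewrite !mulr0.
- by rewrite subrr mulr0 mul0r.
Qed.

Lemma Theta0_SS n m : Theta0 n.+1 m.+1 = Theta0 n m.
Proof. by rewrite /Theta0 ltnS subSS. Qed.

(** Of the total insertion weight [theta + n], a part [i + 1] destroys a given cycle of length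
    [i + 1], and a cycle of length [i] becomes one in [i] ways. By [Theta0_rec] the factors [n - i]
    and [i + 1] add up to [n + 1]. *)
Lemma ewens_sum_count n i :
  i.+1%:R * ewens_sum (fun s : 'S_n => count_cycles i.+1 s)
  = theta * n`!%:R * Theta0 n i.+1.
Proof.
elim: n i => [|n IH] i.
  rewrite (eq_ewens_sum (Y := fun=> 0 * 1)) => [|s]; last by rewrite count_cycles_S0 mul0r.
  by rewrite ewens_sumZ mul0r /Theta0 !mulr0.
rewrite ewens_sum_rec (eq_ewens_sum (Y := fun s =>
   (theta + n%:R - i.+1%:R) * count_cycles i.+1 s
   + (i%:R * count_cycles i s + theta * (i == 0)%:R * 1))); last first.
  move=> s; rewrite count_cycles_insert_max_fix eqSS eq_sym.
  under eq_bigr do rewrite count_cycles_insert_max eqSS.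
  rewrite sumrB big_split /= !sum_porbit_eq sumr_const card_ord; ring.
rewrite !ewens_sumD !ewens_sumZ ewens_sum1 Theta0_SS.
(* For [i = 0] the cycle comes from a new fixed point, and its weight fits the same formula because
   [Theta0 theta n 0] is [Theta theta n]. *)
have -> : i%:R * ewens_sum (fun s : 'S_n => count_cycles i s) +
    theta * (i == 0)%:R * rising theta n = theta * n`!%:R * Theta0 n i.
  case: i => [|i]; last by rewrite IH !(mulr0, mul0r, addr0).
  by rewrite mul0r add0r mulr1 rising_Theta /Theta0 subn0 mulrA.
rewrite mulrDr mulrCA IH mulrCA Theta0_rec factS natrM -!nat1r; ring.
Qed.

(** Ordered pairs of distinct cycles: the diagonal correction gives factorial moments, which have a
    closed form. *)
Definition count_pairs n i j (s : 'S_n) : R :=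
  count_cycles i s * count_cycles j s - (i == j)%:R * count_cycles i s.

(** A pair survives with the weight of the insertions that miss both cycles. The other terms create
    one cycle of the pair, from a cycle shorter by one point or as a new fixed point. *)
Lemma count_pairs_step n i j (s : 'S_n) :
  theta * count_pairs i.+1 j.+1 (insert_max s ord_max)
    + \sum_y count_pairs i.+1 j.+1 (insert_max s (lift ord_max y))
  = (theta + n%:R - (i + j).+2%:R) * count_pairs i.+1 j.+1 s
    + ((i%:R * count_pairs i j.+1 s + theta * (i == 0)%:R * count_cycles j.+1 s)
    + (j%:R * count_pairs i.+1 j s + theta * (j == 0)%:R * count_cycles i.+1 s)).
Proof.
(* Products of indicators of one length collapse to a single indicator, so the summand is affine in
   four indicators and [sum_porbit_eq] sums it. *)
have mulB (l a b : nat) : (l == a)%:R * (l == b)%:R = (a == b)%:R * (l == a)%:R :> R.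
  by case: (eqVneq l a) => [->|]; rewrite ?mul0r ?mulr0 // mul1r mulr1.
pose k a := count_cycles a s; pose d (a b : nat) : R := (a == b)%:R.
rewrite /count_pairs !count_cycles_insert_max_fix !eqSS.
have step (l : nat) : (count_cycles i.+1 s + (l == i)%:R - (l == i.+1)%:R) *
    (count_cycles j.+1 s + (l == j)%:R - (l == j.+1)%:R) -
    (i == j)%:R * (count_cycles i.+1 s + (l == i)%:R - (l == i.+1)%:R)
   = (k i.+1 * k j.+1 - d i j * k i.+1)
     + (k j.+1 - d i j.+1) * (l == i)%:R
     + (d i j + d i j - k j.+1 - d i.+1 j) * (l == i.+1)%:R
     + k i.+1 * (l == j)%:R + - k i.+1 * (l == j.+1)%:R.
  have := mulB l i.+1 j.+1; rewrite eqSS.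
  have := mulB l i.+1 j; have := mulB l i j.+1; have := mulB l i j.
  rewrite /k /d; move: (count_cycles _ _) (count_cycles _ _) => k1 k2.
  move: (l == i)%:R (l == j)%:R (l == i.+1)%:R (l == j.+1)%:R => x x2 z z2.
  move: (i == j)%:R (i == j.+1)%:R (i.+1 == j)%:R => d1 d2 d3.
  lra.
under eq_bigr do rewrite !count_cycles_insert_max !eqSS step.
have lin c0 c1 c2 c3 c4 : \sum_y (c0 + c1 * (#|porbit s y| == i)%:R
      + c2 * (#|porbit s y| == i.+1)%:R + c3 * (#|porbit s y| == j)%:R
      + c4 * (#|porbit s y| == j.+1)%:R)
    = n%:R * c0 + c1 * (i%:R * k i) + c2 * (i.+1%:R * k i.+1) + c3 * (j%:R * k j)
      + c4 * (j.+1%:R * k j.+1).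
  rewrite !big_split /= -!mulr_sumr !sum_porbit_eq; do 4 congr (_ + _).
  by rewrite sumr_const card_ord mulr_natl.
rewrite lin -/(k i) -/(k j) -/(k i.+1) -/(k j.+1).
rewrite [0 == i]eq_sym [0 == j]eq_sym /d -!natr1 natrD.
have [eij|nij] := eqVneq i j.
  rewrite -eij (ltn_eqF (ltnSn i)) (gtn_eqF (ltnSn i)).
  by case: (i == 0) => /=; ring.
(* The two relations between indicators that the final linear arithmetic cannot find when [i] and
   [j] differ. *)
have e2 : (i == 0)%:R * (j == 0)%:R = 0 :> R.
  by move: nij; case: (i) (j) => [|?] [|?]; rewrite ?mulr0 ?mul0r.
have e3 : (i.+1 == j)%:R * (j%:R - 1 - i%:R) = 0 :> R.
  by case: eqP => [<-|]; rewrite ?mul0r // -natr1; ring.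
move: (congr1 (fun z => theta * z) e2) (congr1 (fun z => k i.+1 * z) e3) => /=.
move: (k i) (k j) (k i.+1) (k j.+1) => k1 k2 k3 k4.
move: (i == 0)%:R (j == 0)%:R (i.+1 == j)%:R (i == j.+1)%:R => d1 d2 d3 d4.
lra.
Qed.

Lemma ewens_sum_pairs n i j :
  i.+1%:R * j.+1%:R * ewens_sum (fun s : 'S_n => count_pairs i.+1 j.+1 s)
  = theta ^+ 2 * n`!%:R * Theta0 n (i + j).+2.
Proof.
elim: n i j => [|n IH] i j.
  rewrite (eq_ewens_sum (Y := fun=> 0 * 1)) => [|s].
    by rewrite ewens_sumZ mul0r /Theta0 !mulr0.
  by rewrite /count_pairs !count_cycles_S0; ring.
(* The terms creating the cycle of length [a + 1]. The two halves, with factors [i + 1] and [j + 1],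
   join the factor [n - (i + j + 1)] from [Theta0_rec] to give [n + 1]. *)
have half a b : b.+1%:R * (a%:R * ewens_sum (fun s : 'S_n => count_pairs a b.+1 s) +
    theta * (a == 0)%:R * ewens_sum (fun s : 'S_n => count_cycles b.+1 s))
    = theta ^+ 2 * n`!%:R * Theta0 n (a + b).+1.
  case: a => [|a].
    rewrite mul0r add0r mulr1 mulrCA ewens_sum_count; ring.
  rewrite addSn -IH !(mulr0, mul0r, addr0); ring.
rewrite ewens_sum_rec (eq_ewens_sum (@count_pairs_step n i j)).
rewrite !ewens_sumD !ewens_sumZ Theta0_SS.
have := half j i; rewrite addnC.
have -> : ewens_sum (fun s : 'S_n => count_pairs j i.+1 s) =
  ewens_sum (fun s : 'S_n => count_pairs i.+1 j s).
  apply: eq_ewens_sum => s; rewrite /count_pairs [j == _]eq_sym.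
  by case: (eqVneq i.+1 j) => [->|_] /=; ring.
have := half i j; have := IH i j; have := Theta0_rec n (i + j).+1.
rewrite factS natrM -!natr1 natrD.
move: (Theta0 n _) (Theta0 n _) => T1 T2.
move: (ewens_sum _) (ewens_sum _) (ewens_sum _) (ewens_sum _) (ewens_sum _) => A B C D E.
move: (i == 0)%:R (j == 0)%:R => d1 d2.
move: n`!%:R n%:R i%:R j%:R => f m a b h1 h2 h3 h4.
move: (congr1 ( *%R (theta + m - (a + b + 1 + 1))) h2) => /=.
move: (congr1 ( *%R (a + 1)) h3) (congr1 ( *%R (b + 1)) h4) => /=.
move: (congr1 ( *%R (theta ^+ 2 * f)) h1) => /=.
lra.
Qed.
End Moments.

(** * Symmetric forms triangular in the degree *)

Lemma monic_split (R : realType) (p y : {poly R}) k :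
  size p = k.+1 -> y \is monic -> size y = k.+1 ->
  (size (p - lead_coef p *: y)%R <= k)%N.
Proof.
move=> sp my sy.
apply/leq_sizeP => j; rewrite leq_eqVlt => /orP[/eqP <-|hj].
  move/monicP: my; rewrite /lead_coef sy sp /= => my.
  by rewrite coefB coefZ my mulr1 subrr.
by rewrite coefB coefZ !nth_default ?sp ?sy // mulr0 subrr.
Qed.

Lemma size_scaleD_leq (R : realType) m (a : R) (p q : {poly R}) :
  (size p <= m)%N -> (size q <= m)%N -> (size (a *: p + q)%R <= m)%N.
Proof.
move=> sp sq; rewrite (leq_trans (size_polyD _ _)) // geq_max sq andbT.
exact: leq_trans (size_scale_leq _ _) sp.
Qed.

Section TriangularForm.
Variables (R : realType) (ip bf : {poly R} -> {poly R} -> R).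
Hypothesis ipC : forall p q, ip p q = ip q p.
Hypothesis ipP : forall a p q r, ip (a *: p + q) r = a * ip p r + ip q r.
Hypothesis ip_ge0 : forall p, 0 <= ip p p.
Hypothesis ip_eq0 : forall p, ip p p = 0 -> forall q, ip p q = 0.
Hypothesis bfC : forall p q, bf p q = bf q p.
Hypothesis bfP : forall a p q r, bf (a *: p + q) r = a * bf p r + bf q r.

Let ipPr a p q r : ip r (a *: p + q) = a * ip r p + ip r q.
Proof. by rewrite ipC ipP ipC [ip q r]ipC. Qed.
Let bfPr a p q r : bf r (a *: p + q) = a * bf r p + bf r q.
Proof. by rewrite bfC bfP bfC [bf q r]bfC. Qed.
Let ip0r p : ip p 0 = 0.
Proof. by have := ipPr (-1) 0 0 p; rewrite scaler0 addr0 mulN1r addNr. Qed.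
Let bf0r p : bf p 0 = 0.
Proof. by have := bfPr (-1) 0 0 p; rewrite scaler0 addr0 mulN1r addNr. Qed.

Lemma poly_step (y p : {poly R}) k : y \is monic -> size y = k.+1 ->
  (size p <= k.+1)%N ->
  exists a q, p = a *: y + q /\ (size q <= k)%N.
Proof.
move=> my sy; rewrite leq_eqVlt => /orP[/eqP sp|]; last first.
  by rewrite ltnS => sp; exists 0, p; rewrite scale0r add0r.
exists (lead_coef p), (p - lead_coef p *: y); split; last exact: monic_split.
by rewrite addrC subrK.
Qed.

Lemma monic_sub_small (y r : {poly R}) k : y \is monic -> size y = k.+1 ->
  (size r <= k)%N -> (y - r \is monic) /\ size (y - r) = k.+1.
Proof.
move=> my sy sr; have lt : (size (- r) < size y)%N by rewrite size_polyN sy ltnS.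
by split; [rewrite monicE lead_coefDl // -monicE | rewrite size_polyDl].
Qed.

(** Gram-Schmidt on the monomials. The form may be degenerate: [weight_form] vanishes on polynomials
    that are zero at [1, ..., n]. *)
Lemma orth_proj k (p : {poly R}) :
  exists2 r : {poly R}, (size r <= k)%N &
    forall q : {poly R}, (size q <= k)%N -> ip (p - r) q = 0.
Proof.
elim: k p => [p|k IH p].
  exists 0 => [|q]; first by rewrite size_poly0.
  by rewrite leqn0 size_poly_eq0 => /eqP->; exact: ip0r.
have [r0 sr0 or0] := IH 'X^k; have [r sr orr] := IH p.
have [me se] : ('X^k - r0 \is monic) /\ size ('X^k - r0) = k.+1.
  by apply: monic_sub_small => //; [exact: monicXn | rewrite size_polyXn].
set e := 'X^k - r0 in or0 me se.
(* If [ip e e = 0] then [a = 0], which is correct since [ip p e = 0] too. *)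
pose a := ip p e / ip e e.
exists (a *: e + r).
  by rewrite size_scaleD_leq ?se // leqW.
move=> q /(poly_step me se)[b [q' [-> sq']]].
have -> : p - (a *: e + r) = - a *: e + (p - r) by rewrite scaleNr opprD addrCA.
rewrite ipP !ipPr (or0 _ sq') (orr _ sq') !addr0.
have -> : ip (p - r) e = ip p e.
  have := ipP (-1) r p e; rewrite scaleN1r addrC => ->.
  by rewrite [ip r e]ipC or0 // mulr0 add0r.
have [e0|e0] := eqVneq (ip e e) 0; last by rewrite /a; field.
by rewrite [ip p e]ipC (ip_eq0 e0 p) e0 !mulr0 addr0.
Qed.

(** Orthogonalising each [y] against lower degrees gives an eigenvector for [l], so [bf] splits
    along orthogonal directions, on each of which it is at most [c] times [ip]. *)
Lemma triangular_form_bound (c : R) :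
  (forall k, exists (y P : {poly R}) (l : R),
    [/\ y \is monic, size y = k.+1, (size (P - l *: y)%R <= k)%N, l <= c &
        forall p, bf p y = ip p P]) ->
  forall p, bf p p <= c * ip p p.
Proof.
move=> H.
(* The induction also carries that the operator behind [bf] preserves each degree bound; this makes
   the corrections to [y] harmless. *)
suff main k : forall p : {poly R}, (size p <= k)%N ->
   (exists2 P : {poly R}, (size P <= k)%N & forall q, bf q p = ip q P)
   /\ bf p p <= c * ip p p.
  by move=> p; case: (main _ p (leqnn _)).
elim: k => [p|k IH p].
  rewrite leqn0 size_poly_eq0 => /eqP->; split.
    by exists 0 => [|q]; rewrite ?size_poly0 // bf0r ip0r.
  by rewrite bf0r ip0r mulr0.
have [y [Y [l [my sy sY lc yY]]]] := H k.
have [r sr orr] := orth_proj k y.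
have [me se] := monic_sub_small my sy sr.
set e := y - r in orr me se.
have [[Rr sR rR] _] := IH _ sr.
have ye : y = 1 *: e + r by rewrite scale1r /e subrK.
(* The image of [e = y - r] is [Y - Rr], written as [l *: e] plus terms of lower degree. *)
have Ee q : bf q e = ip q (l *: e + (l *: r + (Y - l *: y) - Rr)).
  have -> : l *: e + (l *: r + (Y - l *: y) - Rr) = -1 *: Rr + Y.
    by rewrite /e scalerBr scaleN1r !addrA subrK [l *: y + Y]addrC addrK addrC.
  rewrite ipPr -rR -yY ye bfPr; ring.
have sL : (size (l *: r + (Y - l *: y) - Rr)%R <= k)%N.
  rewrite (leq_trans (size_polyD _ _)) // geq_max size_polyN sR andbT.
  exact: size_scaleD_leq.
move=> /(poly_step me se)[b [q [-> sq]]]; have [[Q sQ qQ] bq] := IH _ sq.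
(* [e] is orthogonal to all lower degrees, so the lower-order part of its image
   contributes nothing and [e] acts as an eigenvector for [l]. *)
have [eq0 be] : bf e q = 0 /\ bf e e = l * ip e e.
  by rewrite qQ orr // Ee ipPr (orr _ sL) addr0.
split.
  exists (b *: (l *: e + (l *: r + (Y - l *: y) - Rr)) + Q).
    by rewrite !size_scaleD_leq ?se // leqW.
  by move=> q'; rewrite bfPr Ee qQ ipPr.
rewrite bfP !bfPr [bf q e]bfC eq0 be ipP !ipPr [ip q e]ipC (orr _ sq).
have le1 : l * (b ^+ 2 * ip e e) <= c * (b ^+ 2 * ip e e).
  by apply: ler_wpM2r => //; rewrite mulr_ge0 // sqr_ge0.
by move: le1 bq; rewrite expr2; lra.
Qed.
End TriangularForm.

(** * The covariance kernel *)

Section Rising.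
Variable R : realType.
Implicit Types (x theta : R) (k : nat).

Lemma rising0 x : rising x 0 = 1.
Proof. by rewrite /rising big_ord0. Qed.

Lemma risingS x k : rising x k.+1 = rising x k * (x + k%:R).
Proof. by rewrite /rising big_ord_recr. Qed.

Lemma risingSl x k : rising x k.+1 = x * rising (x + 1) k.
Proof.
rewrite /rising big_ord_recl addr0; congr (_ * _).
by apply: eq_bigr => t _; rewrite -addrA nat1r.
Qed.

Lemma rising_gt0 x k : 0 < x -> 0 < rising x k.
Proof. by move=> x0; apply: prodr_gt0 => t _; rewrite ltr_wpDr ?ler0n. Qed.

Lemma rising_diff x k : rising (x + 1) k.+1 = rising x k.+1 + k.+1%:R * rising (x + 1) k.
Proof. by rewrite risingS [rising x k.+1]risingSl -natr1; ring. Qed.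

Lemma Theta_gt0 theta m : 0 < theta -> 0 < Theta theta m.
Proof. by move=> t0; rewrite divr_gt0 ?rising_gt0 // ltr0n fact_gt0. Qed.

(** Compare coefficients of [z^m] in the product of [k! z / (1 - z)^(k+1)], which generates [(j)_k],
    and [(1 - z)^(-theta)], which generates [Theta]. The proof is a double induction on [k] and
    [m]. *)
Lemma rising_convolution theta k m :
  rising theta k.+1 *
    (\sum_(j < m) rising j.+1%:R k * Theta theta (m - j.+1))
  = k`!%:R * (Theta theta m * (m%:R * rising (theta + m%:R) k)).
Proof.
elim: k m => [|k IHk] m.
  rewrite risingS !rising0 addr0 !mul1r mulr1.
  under eq_bigr do rewrite rising0 mul1r.
  elim: m => [|m IHm]; first by rewrite big_ord0 !mulr0.
  rewrite big_ord_recl subSS subn0 mulrDr.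
  under eq_bigr do rewrite subSS.
  by rewrite IHm [RHS]mulrC Theta_rec; ring.
elim: m => [|m IHm]; first by rewrite big_ord0 !(mulr0, mul0r).
(* By [rising_diff] the difference of [(j)_(k+1)] in [j] is a multiple of [(j)_k]; the boundary term
   is [(0)_(k+1) = 0]. *)
have -> : \sum_(j < m.+1) rising j.+1%:R k.+1 * Theta theta (m.+1 - j.+1) =
    \sum_(j < m) rising j.+1%:R k.+1 * Theta theta (m - j.+1)
    + k.+1%:R * \sum_(j < m.+1) rising j.+1%:R k * Theta theta (m.+1 - j.+1).
  under eq_bigr do rewrite -natr1 rising_diff mulrDl -mulrA natr1.
  rewrite big_split /= -mulr_sumr; congr (_ + _).
  rewrite big_ord_recl risingSl !mul0r add0r.
  by apply: eq_bigr => j _; rewrite lift0 subSS.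
rewrite mulrDr IHm [rising theta k.+2]risingS.
rewrite [X in _ + X](_ : _ = (theta + k.+1%:R) * k.+1%:R *
   (rising theta k.+1 *
     \sum_(j < m.+1) rising j.+1%:R k * Theta theta (m.+1 - j.+1))); last by ring.
rewrite IHk [Theta theta m.+1 * _]mulrA [Theta theta m.+1 * _]mulrC Theta_rec.
rewrite [Theta theta m.+1 * _]mulrA [Theta theta m.+1 * _]mulrC Theta_rec.
rewrite [rising (theta + m.+1%:R) k.+1]risingS risingSl -addrA natr1.
rewrite factS natrM -!natr1; ring.
Qed.

(** After the first factor [theta + 1], each factor [theta + 1 + t] is at least [t + 1]. *)
Lemma fact_le_rising theta k : 0 < theta ->
  k.+1`!%:R * (theta + 1) <= rising (theta + 1) k.+1.
Proof.
move=> t0; elim: k => [|k IH]; first by rewrite risingS rising0 addr0.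
rewrite risingS factS natrM -mulrA mulrC ler_pM //.
  by rewrite mulr_ge0 ?ler0n // addr_ge0 // ltW.
by rewrite -natr1; lra.
Qed.

Definition rising_poly k : {poly R} := \prod_(t < k) ('X - (- t%:R)%:P).

Lemma horner_rising_poly k x : (rising_poly k).[x] = rising x k.
Proof.
by rewrite horner_prod; apply: eq_bigr => t _; rewrite hornerXsubC opprK.
Qed.

Lemma rising_poly_monic k : rising_poly k \is monic.
Proof. exact: monic_prod_XsubC. Qed.

Lemma size_rising_poly k : size (rising_poly k) = k.+1.
Proof. by rewrite size_prod_XsubC -sum1_size sum1_card card_ord. Qed.

Lemma monic_divX (p : {poly R}) k : p \is monic -> size p = k.+2 ->
  exists q : {poly R}, [/\ q \is monic, size q = k.+1 & forall x, p.[x] - p.[0] = x * q.[x]].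
Proof.
move=> mp sp.
have [mp0 sp0] := monic_sub_small mp sp (leq_trans (size_polyC_leq1 p.[0]) (ltn0Sn k)).
have /factor_theorem [q qE] : root (p - p.[0]%:P) 0 by rewrite rootE !hornerE subrr.
have mq : q \is monic by move: mp0; rewrite qE monicMr // monicXsubC.
exists q; split=> // [|x].
  by move: sp0; rewrite qE size_Mmonic ?monicXsubC ?monic_neq0 // size_XsubC addn2 => -[].
by move/(congr1 (fun r => r.[x])): qE; rewrite !hornerE => ->; rewrite subr0 mulrC.
Qed.

(** Lagrange interpolation: every vector is the list of values of a polynomial, so bounds on
    polynomials transfer to vectors. *)
Lemma interpolation n (x : 'I_n -> R) :
  exists p : {poly R}, forall j : 'I_n, p.[j.+1%:R] = x j.
Proof.
pose L (j : 'I_n) : {poly R} := \prod_(i < n | i != j) ('X - i.+1%:R%:P).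
have L0 j i : i != j -> (L j).[i.+1%:R] = 0.
  by move=> ij; rewrite horner_prod (bigD1 i) //= hornerXsubC subrr mul0r.
have L1 j : (L j).[j.+1%:R] != 0.
  rewrite horner_prod; apply/prodf_neq0 => i ij.
  by rewrite hornerXsubC subr_eq0 eqr_nat eqSS eq_sym.
exists (\sum_j (x j / (L j).[j.+1%:R]) *: L j) => j.
rewrite horner_sum (bigD1 j) //= hornerZ divfK // big1 ?addr0 // => i ij.
have ji : j != i by rewrite eq_sym.
by rewrite hornerZ (L0 _ _ ji) mulr0.
Qed.
End Rising.

(** * Action of the kernel on polynomials and the spectral bound *)

Section Kernel.
Variables (R : realType) (theta : R) (n : nat).
Hypothesis theta_gt0 : 0 < theta.

Definition weight (j : 'I_n) : R := j.+1%:R * Theta theta (n - j.+1).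
(** Times [theta / Theta theta n], this is the covariance of the numbers of points in cycles of
    lengths [i + 1] and [j + 1], without the diagonal part, which is [weight]. *)
Definition kernel (i j : 'I_n) : R := theta * (Theta0 theta n (i + j).+2
  - Theta theta (n - i.+1) * Theta theta (n - j.+1) / Theta theta n).

Lemma weight_gt0 j : 0 < weight j.
Proof. by rewrite mulr_gt0 ?ltr0n ?Theta_gt0. Qed.

Lemma kernelC i j : kernel i j = kernel j i.
Proof. by rewrite /kernel addnC [Theta _ (n - j.+1) * _]mulrC. Qed.

Lemma sum_Theta0 (f : nat -> R) (i : 'I_n) :
  \sum_(j < n) f j.+1 * Theta0 theta n (i + j).+2
  = \sum_(j < n - i.+1) f j.+1 * Theta theta (n - i.+1 - j.+1).
Proof.
rewrite (big_ord_widen n (fun j => f j.+1 * Theta theta (n - i.+1 - j.+1))) ?leq_subr //.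
rewrite [RHS]big_mkcond; apply: eq_bigr => j _.
rewrite /Theta0 -addnS -addSn -subnDA ltn_subRL -addnS.
by case: ifP; rewrite ?mulr0.
Qed.

(** The two terms of the kernel give convolutions of lengths [n - (i + 1)] and [n], both known from
    [rising_convolution]. *)
Lemma kernel_rising k (i : 'I_n) :
  \sum_j kernel i j * rising j.+1%:R k =
  theta * k`!%:R / rising theta k.+1 * Theta theta (n - i.+1) *
   ((n%:R - i.+1%:R) * rising (theta + (n%:R - i.+1%:R)) k - n%:R * rising (theta + n%:R) k).
Proof.
have T0 : Theta theta n != 0 by rewrite gt_eqF ?Theta_gt0.
have r0 : rising theta k.+1 != 0 by rewrite gt_eqF ?rising_gt0.
rewrite (eq_bigr (fun j : 'I_n => theta * (rising j.+1%:R k * Theta0 theta n (i + j).+2)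
  - theta * Theta theta (n - i.+1) / Theta theta n *
     (rising j.+1%:R k * Theta theta (n - j.+1)))) => [|j _]; last first.
  by rewrite /kernel; field.
rewrite sumrB -!mulr_sumr (sum_Theta0 (fun j => rising j%:R k)).
have := rising_convolution theta k (n - i.+1).
have := rising_convolution theta k n.
rewrite -natrB //; move: (\sum_(_ < _) _) (\sum_(_ < _) _) => s2 s1 e1 e2.
have -> : s1 =
    k`!%:R * (Theta theta n * (n%:R * rising (theta + n%:R) k)) / rising theta k.+1.
  by rewrite -e1 mulrAC mulfV ?mul1r.
have -> : s2 = k`!%:R * (Theta theta (n - i.+1) *
    ((n - i.+1)%:R * rising (theta + (n - i.+1)%:R) k)) / rising theta k.+1.
  by rewrite -e2 mulrAC mulfV ?mul1r.
by field; apply/andP.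
Qed.

(** For even [k] the left side is not positive; for odd [k] the factorial estimate applies, with
    equality at [k = 1]. *)
Lemma eigenvalue_le k :
  (-1) ^+ k.+1 * (theta * k`!%:R / rising theta k.+1) <= (theta + 1)^-1.
Proof.
have t1 : 0 < theta + 1 by rewrite ltr_wpDr.
have -> : theta * k`!%:R / rising theta k.+1 = k`!%:R / rising (theta + 1) k.
  rewrite risingSl invfM mulrACA divff ?mul1r // gt_eqF //.
have [ko|ke] := boolP (odd k); last first.
  rewrite -signr_odd /= ke expr1 mulN1r (@le_trans _ _ 0) //.
    by rewrite oppr_le0 divr_ge0 ?ler0n // ltW // rising_gt0.
  by rewrite invr_ge0 ltW.
rewrite -signr_odd /= ko expr0 mul1r.
case: k ko => // k _.
by rewrite ler_pdivrMr ?rising_gt0 // mulrC ler_pdivlMr // fact_le_rising.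
Qed.

Definition weight_form (p q : {poly R}) : R :=
  \sum_(j < n) weight j * (p.[j.+1%:R] * q.[j.+1%:R]).
Definition kernel_form (p q : {poly R}) : R :=
  \sum_(i < n) \sum_(j < n) p.[i.+1%:R] * (kernel i j * q.[j.+1%:R]).

Lemma kernel_triangular k : exists (y P : {poly R}) (l : R),
  [/\ y \is monic, size y = k.+1, (size (P - l *: y)%R <= k)%N,
      l <= (theta + 1)^-1 & forall p, kernel_form p y = weight_form p P].
Proof.
(* The roots in [x] of [(n - x) (theta + n - x)_k]; index 0 is the root [n], hence the shift [t.-1]
   for the others. *)
pose c (t : 'I_k.+1) : R := if t == ord0 then n%:R else theta + n%:R + t.-1%:R.
pose N : {poly R} := \prod_(t < k.+1) ('X - (c t)%:P).
have NE x : (-1) ^+ k.+1 * N.[x] = (n%:R - x) * rising (theta + (n%:R - x)) k.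
  rewrite /N horner_prod big_ord_recl exprS mulrACA; congr (_ * _).
    by rewrite hornerXsubC /c eqxx mulN1r opprB.
  rewrite -{1}(card_ord k) -prodrN; apply: eq_bigr => t _.
  by rewrite hornerXsubC /c /= opprB; ring.
have mN : N \is monic by exact: monic_prod_XsubC.
have sN : size N = k.+2 by rewrite size_prod_XsubC -sum1_size sum1_card card_ord.
have [Q [mQ sQ QE]] := monic_divX mN sN.
pose l : R := (-1) ^+ k.+1 * (theta * k`!%:R / rising theta k.+1).
exists (rising_poly R k), (l *: Q), l; split.
- exact: rising_poly_monic.
- exact: size_rising_poly.
- rewrite -scalerBr (leq_trans (size_scale_leq _ _)) //.
  have := monic_split sQ (rising_poly_monic R k) (size_rising_poly R k).
  by move/monicP: mQ => ->; rewrite scale1r.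
- exact: eigenvalue_le.
move=> p; apply: eq_bigr => i _; rewrite -mulr_sumr.
under eq_bigr do rewrite horner_rising_poly.
(* The subtracted term of [kernel_rising] is the value of [N] at 0, so the difference is divisible
   by [i + 1], a factor which [weight] absorbs. *)
rewrite kernel_rising -NE -[X in X * rising (theta + X) k]subr0 -NE -mulrBr QE.
by rewrite hornerZ /weight /l; ring.
Qed.

Lemma weight_form_eq0 p : weight_form p p = 0 -> forall q, weight_form p q = 0.
Proof.
move=> /eqP; rewrite psumr_eq0 => [/allP h q|j _]; last first.
  by rewrite mulr_ge0 ?(ltW (weight_gt0 _)) // -expr2 sqr_ge0.
apply: big1 => j _; have := h j (mem_index_enum _).
by rewrite mulf_eq0 gt_eqF ?weight_gt0 //= -expr2 sqrf_eq0 => /eqP->; rewrite mul0r mulr0.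
Qed.

Lemma kernel_bound (x : 'I_n -> R) :
  \sum_i \sum_j x i * (kernel i j * x j) <= (theta + 1)^-1 * \sum_j weight j * (x j * x j).
Proof.
have [p px] := interpolation x.
rewrite (_ : \sum_j weight j * _ = weight_form p p); last first.
  by apply: eq_bigr => j _; rewrite !px.
rewrite (_ : \sum_i _ = kernel_form p p); last first.
  by apply: eq_bigr => i _; apply: eq_bigr => j _; rewrite !px.
move: p {px}; apply: (triangular_form_bound _ _ _ _ _ _ kernel_triangular).
- by move=> p q; apply: eq_bigr => j _; rewrite [p.[_] * _]mulrC.
- move=> a p q r; rewrite /weight_form mulr_sumr -big_split; apply: eq_bigr => j _ /=.
  by rewrite hornerD hornerZ; ring.
- move=> p; apply: sumr_ge0 => j _.
  by rewrite mulr_ge0 ?(ltW (weight_gt0 _)) // -expr2 sqr_ge0.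
- exact: weight_form_eq0.
- move=> p q; rewrite /kernel_form exchange_big.
  apply: eq_bigr => i _; apply: eq_bigr => j _ /=.
  by rewrite kernelC mulrCA mulrA mulrC mulrCA.
- move=> a p q r; rewrite /kernel_form mulr_sumr -big_split; apply: eq_bigr => i _ /=.
  rewrite mulr_sumr -big_split; apply: eq_bigr => j _ /=.
  by rewrite hornerD hornerZ; ring.
Qed.

(** In operator form [K 1 = -1] and [(K j)_i = (i - 2 n - theta) / (theta + 1)]; the constant term
    is chosen to make the combination an eigenvector. *)
Lemma kernel_extremal (i : 'I_n) :
  \sum_j kernel i j * ((theta + 2) * j.+1%:R - (2 * n%:R + theta))
  = (theta + 1)^-1 * (weight i * ((theta + 2) * i.+1%:R - (2 * n%:R + theta))).
Proof.
rewrite (eq_bigr (fun j => (theta + 2) * (kernel i j * rising j.+1%:R 1)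
   - (2 * n%:R + theta) * (kernel i j * rising j.+1%:R 0))) => [|j _]; last first.
  by rewrite risingS !rising0; ring.
rewrite sumrB -!mulr_sumr !kernel_rising !(risingS, rising0) /weight fact0.
have t1 : theta + 1 != 0 by rewrite gt_eqF // ltr_wpDr.
have t0 : theta != 0 by rewrite gt_eqF.
by rewrite factS fact0; field; apply/andP.
Qed.
End Kernel.

(** * The variance in terms of the kernel, and the extremal vector *)

Section Variance.
Variables (R : realType) (theta : R) (n : nat).
Hypothesis theta_gt0 : 0 < theta.

Notation E X := (mass_expectation (@ewens R n theta) X).

Lemma expectation_ewens_sum (X : 'S_n -> R) : E X = ewens_sum theta X / rising theta n.
Proof.
rewrite /mass_expectation /ewens_sum mulr_suml; apply: eq_bigr => s _.
by rewrite /ewens mulrAC.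
Qed.

Lemma ewens_sum_sum m (I : finType) (c : I -> R) (X : I -> 'S_m -> R) :
  ewens_sum theta (fun s => \sum_i c i * X i s) = \sum_i c i * ewens_sum theta (X i).
Proof.
rewrite /ewens_sum; under eq_bigr do rewrite mulr_sumr.
rewrite exchange_big; apply: eq_bigr => i _; rewrite mulr_sumr.
by apply: eq_bigr => s _; rewrite mulrCA.
Qed.

Lemma variance_ewens_sum (X : 'S_n -> R) :
  mass_variance (@ewens R n theta) X
  = ewens_sum theta (fun s => X s ^+ 2) / rising theta n
    - (ewens_sum theta X / rising theta n) ^+ 2.
Proof.
have r0 : rising theta n != 0 by rewrite gt_eqF ?rising_gt0.
rewrite /mass_variance !expectation_ewens_sum; set m := ewens_sum theta X / _.
rewrite (eq_ewens_sum _ (Y := fun s =>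
  X s ^+ 2 + ((- (2 * m)) * X s + m ^+ 2 * 1))); last first.
  by move=> s; ring.
by rewrite !ewens_sumD !ewens_sumZ ewens_sum1 /m; field.
Qed.

Lemma Dn_kernel (a : 'rV[R]_n) (x := fun j => a 0 j / j.+1%:R) :
  Dn theta a = theta / Theta theta n *
    (\sum_j weight theta j * (x j * x j)
     + \sum_i \sum_j x i * (kernel theta i j * x j)).
Proof.
have T0 : Theta theta n != 0 by rewrite gt_eqF ?Theta_gt0.
have f0 : n`!%:R != 0 :> R by rewrite pnatr_eq0 -lt0n fact_gt0.
have ax j : a 0 j = x j * j.+1%:R by rewrite /x divfK // pnatr_eq0.
have T0E (j : 'I_n) : Theta0 theta n j.+1 = Theta theta (n - j.+1) by rewrite /Theta0 ltn_ord.
have e1 : ewens_sum theta (additive_fun a) =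
    theta * n`!%:R * \sum_j x j * Theta theta (n - j.+1).
  rewrite /additive_fun ewens_sum_sum mulr_sumr; apply: eq_bigr => j _.
  by rewrite ax -mulrA (ewens_sum_count theta n j) T0E; ring.
have e2 : ewens_sum theta (fun s => additive_fun a s ^+ 2) =
    theta * n`!%:R * (\sum_j weight theta j * (x j * x j)
      + \sum_i \sum_j x i * x j * (theta * Theta0 theta n (i + j).+2)).
  (* Each product of counts is a pair count plus, on the diagonal, a single count; the latter yields
     the [weight] sum. *)
  rewrite (eq_ewens_sum _ (Y := fun s => \sum_i a 0 i * (\sum_j a 0 j *
      (count_pairs R i.+1 j.+1 s + (i == j)%:R * count_cycles R i.+1 s)))); last first.
    move=> s; rewrite expr2 {1}/additive_fun mulr_suml; apply: eq_bigr => i _.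
    rewrite -mulrA; congr (_ * _); rewrite /additive_fun mulr_sumr.
    by apply: eq_bigr => j _; rewrite /count_pairs eqSS /count_cycles -val_eqE /=; ring.
  rewrite ewens_sum_sum -big_split mulr_sumr; apply: eq_bigr => i _.
  rewrite ewens_sum_sum /=; under eq_bigr do rewrite ewens_sumD ewens_sumZ mulrDr.
  rewrite big_split /= [X in _ + X](bigD1 i) //= eqxx mul1r.
  rewrite [X in _ + (_ + X)]big1 => [|j ji]; last by rewrite eq_sym (negPf ji) mul0r mulr0.
  rewrite addr0 addrC !mulrDr; congr (_ + _).
    rewrite !ax /weight; have := ewens_sum_count theta n i; rewrite T0E.
    move=> /(congr1 ( *%R (x i * x i * i.+1%:R))); lra.
  rewrite !mulr_sumr; apply: eq_bigr => j _; rewrite !ax.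
  by have /(congr1 ( *%R (x i * x j))) := ewens_sum_pairs theta n i j; lra.
rewrite /Dn variance_ewens_sum e1 e2 rising_Theta.
set S1 := \sum_j weight _ _ * _.
(* The rank-one part of the kernel accounts for the squared mean. *)
have -> : \sum_i \sum_j x i * (kernel theta i j * x j) =
   \sum_i \sum_j x i * x j * (theta * Theta0 theta n (i + j).+2)
   - theta / Theta theta n * (\sum_j x j * Theta theta (n - j.+1)) ^+ 2.
  rewrite expr2 mulr_suml mulr_sumr -sumrB; apply: eq_bigr => i _.
  rewrite !mulr_sumr -sumrB; apply: eq_bigr => j _.
  by rewrite /kernel; field.
by field; apply/andP.
Qed.

Lemma Bn_weight (a : 'rV[R]_n) (x := fun j => a 0 j / j.+1%:R) :
  Bn theta a = (\sum_j weight theta j * (x j * x j)) / Theta theta n.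
Proof.
rewrite /Bn mulr_suml; apply: eq_bigr => j _.
have T0 : Theta theta n != 0 by rewrite gt_eqF ?Theta_gt0.
have j0 : j.+1%:R != 0 :> R by rewrite pnatr_eq0.
by rewrite /weight /x; field; rewrite nat1r T0 j0.
Qed.

Lemma weight_form_gt0 (a : 'rV[R]_n) : a != 0 ->
  0 < \sum_j weight theta j * (a 0 j / j.+1%:R * (a 0 j / j.+1%:R)).
Proof.
move=> a0; have ge0 (j : 'I_n) : true ->
    0 <= weight theta j * (a 0 j / j.+1%:R * (a 0 j / j.+1%:R)).
  by move=> _; rewrite mulr_ge0 ?(ltW (weight_gt0 theta_gt0 _)) // -expr2 sqr_ge0.
rewrite lt_def sumr_ge0 // andbT; apply: contra_neq a0 => /eqP.
rewrite psumr_eq0 // => /allP h; apply/rowP => j; rewrite mxE.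
have := h j (mem_index_enum _).
rewrite mulf_eq0 gt_eqF ?weight_gt0 //= -expr2 sqrf_eq0 mulf_eq0 invr_eq0 pnatr_eq0.
by rewrite orbF => /eqP.
Qed.

Lemma variance_ratioE (a : 'rV[R]_n) (x := fun j => a 0 j / j.+1%:R) : a != 0 ->
  variance_ratio theta a = 1 + (\sum_i \sum_j x i * (kernel theta i j * x j))
    / \sum_j weight theta j * (x j * x j).
Proof.
move=> /weight_form_gt0; rewrite /variance_ratio Dn_kernel Bn_weight -/x.
move: (\sum_j weight _ _ * _) (\sum_i _) => S1 S2 S10.
have T0 : Theta theta n != 0 by rewrite gt_eqF ?Theta_gt0.
have t0 : theta != 0 by rewrite gt_eqF.
have s0 : S1 != 0 by rewrite gt_eqF.
by field; do ?[apply/and3P; split|apply/andP; split].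
Qed.

Lemma variance_ratio_le (a : 'rV[R]_n) : a != 0 ->
  variance_ratio theta a <= (theta + 2) / (theta + 1).
Proof.
move=> a0; have t1 : theta + 1 != 0 by rewrite gt_eqF // ltr_wpDr.
have -> : (theta + 2) / (theta + 1) = 1 + (theta + 1)^-1 by field.
rewrite variance_ratioE // lerD2l ler_pdivrMr ?weight_form_gt0 //.
exact: (kernel_bound theta_gt0 (fun j => a 0 j / j.+1%:R)).
Qed.

Lemma extremal_vector_neq0 : (2 <= n)%N -> extremal_vector n theta != 0.
Proof.
move=> n2; have n0 : (0 < n)%N by exact: ltnW.
(* The first entry is [2 - 2 n], nonzero exactly because [n] is not 1. *)
apply/eqP => /rowP/(_ (Ordinal n0)); rewrite !mxE /= => h.
have : 2 <= n%:R :> R by rewrite ler_nat.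
by move: h; rewrite expr1n; lra.
Qed.

Lemma variance_ratio_extremal : (2 <= n)%N ->
  variance_ratio theta (extremal_vector n theta) = (theta + 2) / (theta + 1).
Proof.
move=> n2; have a0 := extremal_vector_neq0 n2.
have t1 : theta + 1 != 0 by rewrite gt_eqF // ltr_wpDr.
have := weight_form_gt0 a0; rewrite variance_ratioE //.
pose y (j : 'I_n) := (theta + 2) * j.+1%:R - (2 * n%:R + theta).
have yE j : extremal_vector n theta 0 j / j.+1%:R = y j.
  have j0 : j.+1%:R != 0 :> R by rewrite pnatr_eq0.
  by rewrite mxE /y; field; rewrite nat1r.
set x := extremal_vector n theta 0 in yE *.
have -> : \sum_i \sum_j x i / i.+1%:R * (kernel theta i j * (x j / j.+1%:R)) =
    (theta + 1)^-1 * \sum_j weight theta j * (x j / j.+1%:R * (x j / j.+1%:R)).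
  rewrite mulr_sumr; apply: eq_bigr => i _; rewrite -mulr_sumr.
  under eq_bigr do rewrite yE.
  by rewrite kernel_extremal // -/(y i) yE; ring.
by move=> /lt0r_neq0 s0; rewrite mulfK //; field.
Qed.
End Variance.

Theorem theorem1 (R : realType) (theta : R) (n : nat)
    (htheta : 0 < theta) (hn : (2 <= n)%N) :
  tau n theta = (theta + 2) / (theta + 1) /\
  (extremal_vector n theta != 0 /\ variance_ratio theta (extremal_vector n theta) = tau n theta).
Proof.
have v0 := extremal_vector_neq0 theta hn.
have vE := variance_ratio_extremal htheta hn.
suff -> : tau n theta = (theta + 2) / (theta + 1) by [].
set A := [set variance_ratio theta a | a in [set a : 'rV[R]_n | a != 0]]%classic.
have uA : ubound A ((theta + 2) / (theta + 1)).
  by move=> _ [a a0 <-]; exact: variance_ratio_le.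
(* The upper bound is attained, so it is a maximum; membership also gives the nonemptiness that
   [sup] requires. *)
have inA : A ((theta + 2) / (theta + 1)) by exists (extremal_vector n theta).
apply/eqP; rewrite eq_le; apply/andP; split.
  by apply: ge_sup => //; exists ((theta + 2) / (theta + 1)).
by apply: ub_le_sup => //; exists ((theta + 2) / (theta + 1)).
Qed.
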